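(* Let $E=TM\oplus T^*M\oplus\mathcal G$ be a standard Courant algebroid. There is a natural bijection between non-degenerate generalised almost complex structures $\mathcal J$ on $E$ and data $J\in\Gamma(\mathrm{End}\,TM)$, $\tilde A\in\Gamma(\mathrm{End}\,\mathcal G)$, $B:T^*M\to TM$ bijective, $\nu:T^*M\to\mathcal G$, subject to the skew-symmetry conditions $$B^*=-B,\qquad\tilde A^*=-\tilde A$$ and the quadratic equations $$\tilde A^2=-\mathrm{Id},\qquad JB-BJ^*=\nu^*\nu.$$ The remaining components $A$, $C$ and $\mu$ of $\mathcal J$ are given by $$A=\tilde A-\nu B^{-1}\nu^*,$$ $$C=-B^{-1}(\nu^*\tilde A\nu B^{-1}+\mathrm{Id})-J^*B^{-1}J,$$ $$\mu=\nu B^{-1}J-\tilde A\nu B^{-1}.$$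
   Context: $M$ is a connected smooth manifold and $\mathcal G\to M$ a bundle of quadratic Lie algebras with scalar product (non-degenerate symmetric bilinear form) $\langle\cdot,\cdot\rangle_{\mathcal G}$. The standard Courant algebroid $E=TM\oplus T^*M\oplus\mathcal G$ has anchor the projection $\pi:E\to TM$ and scalar product $\langle X+\xi+r,Y+\eta+\tilde r\rangle=\frac12(\eta(X)+\xi(Y))+\langle r,\tilde r\rangle_{\mathcal G}$ (its bracket plays no role here); it is of neutral signature unless otherwise stated. A generalised almost complex structure on $E$ is a skew-symmetric $\mathcal J\in\Gamma(\mathrm{End}\,E)$ with $\mathcal J^2=-\mathrm{Id}$. Its components $J,A,B,C,\mu,\nu$ are defined by the block form $$\mathcal J=\begin{pmatrix}J&B&-\nu^*\\ C&-J^*&-\mu^*\\ \mu&\nu&A\end{pmatrix}$$ with respect to $E=TM\oplus T^*M\oplus\mathcal G$, where $*$ denotes adjoints with respect to the scalar product of $E$: $(J^*\xi)(X)=\xi(JX)$, $\eta(B^*\xi)=\xi(B\eta)$, $\langle\tilde A^*r,s\rangle_{\mathcal G}=\langle r,\tilde As\rangle_{\mathcal G}$, $\xi(\nu^*r)=2\langle r,\nu\xi\rangle_{\mathcal G}$, $(\mu^*r)(X)=2\langle r,\mu X\rangle_{\mathcal G}$. $\mathcal J$ is non-degenerate if $B=\pi\circ\mathcal J|_{T^*M}:T^*M\to TM$ is bijective. *)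

(* Defs.v *)
From HB Require Import structures.
From mathcomp Require Import all_boot all_order all_algebra.
From mathcomp Require Import boolp classical_sets functions cardinality.
From mathcomp Require Import reals topology normedtype derive.

Set Implicit Arguments.
Unset Strict Implicit.
Unset Printing Implicit Defensive.

Import Order.TTheory GRing.Theory Num.Theory.
Import numFieldNormedType.Exports.

Local Open Scope classical_set_scope.
Local Open Scope ring_scope.

(* The derivative of order k.+1 is taken directionally, but Frechet
   differentiability is required at each order, so that [smooth_on U f] is
   C^oo on the open set [U]. *)
Fixpoint Ck_on (R : realType) (V W : normedModType R) (k : nat) (U : set V)
    (f : V -> W) : Prop :=
  if k is k'.+1 then
    (forall x, U x -> differentiable f x) /\
    (forall v, Ck_on k' U (fun x => 'D_v f x))
  else forall x, U x -> {for x, continuous f}.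

Definition smooth_on (R : realType) (V W : normedModType R) (U : set V)
  (f : V -> W) : Prop := forall k, Ck_on k U f.

(* [chart i] and [cinv i] are total functions, meaningful on [cdom i] and
   [chart i @` cdom i] only. The atlas need not be maximal. [chart_at p] is an
   auxiliary choice of a chart around [p]. *)
Record manifold (R : realType) (n : nat) := Manifold {
  mspace :> topologicalType;
  chart_idx : Type;
  cdom : chart_idx -> set mspace;
  chart : chart_idx -> mspace -> 'rV[R]_n;
  cinv : chart_idx -> 'rV[R]_n -> mspace;
  chart_at : mspace -> chart_idx;
  cdom_open : forall i, open (cdom i);
  cimg_open : forall i, open (chart i @` cdom i);
  chartK : forall i p, cdom i p -> cinv i (chart i p) = p;
  chart_continuous : forall i p, cdom i p -> {for p, continuous (chart i)};
  cinv_continuous : forall i x,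
    (chart i @` cdom i) x -> {for x, continuous (cinv i)};
  chart_atP : forall p, cdom (chart_at p) p;
  transition_smooth : forall i j,
    smooth_on (chart i @` (cdom i `&` cdom j)) (chart j \o cinv i);
  manifold_hausdorff : hausdorff_space mspace;
  manifold_second_countable : @second_countable mspace
}.

Definition smooth_fun (R : realType) (n : nat) (M : manifold R n)
    (U : set M) (f : M -> R) : Prop :=
  forall i, smooth_on (chart i @` (U `&` cdom i)) (f \o cinv i : _ -> R^o).

(* A family of vector spaces together with a family of local trivialisations
   over the sets [tdom i]; [is_vbundle] says that these form an atlas of a
   smooth vector bundle. *)
Record bundle_data (R : realType) (n : nat) (M : manifold R n) := BundleData {
  rk : nat;
  fib :> M -> vectType R;
  triv_idx : Type;
  tdom : triv_idx -> set M;
  triv : triv_idx -> forall p, 'Hom(fib p, 'rV[R]_rk)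
}.

Section Bundles.
Context {R : realType} {n : nat} {M : manifold R n}.
Implicit Types E F : bundle_data M.

Definition frame E (i : triv_idx E) (a : 'I_(rk E)) (p : M) : E p :=
  ((triv i p)^-1)%VF (delta_mx 0 a).

Definition is_vbundle E : Prop :=
  [/\ forall i : triv_idx E, open (tdom i),
      forall p, exists i : triv_idx E, tdom i p,
      forall (i : triv_idx E) p, tdom i p -> bijective (triv i p) &
      forall (i j : triv_idx E) a b,
        smooth_fun (tdom i `&` tdom j)
          (fun p => triv j p (frame i a p) 0 b)].

Definition bmap E F := forall p, 'Hom(E p, F p).

Definition smooth_bmap E F (f : bmap E F) : Prop :=
  forall (i : triv_idx E) (j : triv_idx F) a b,
    smooth_fun (tdom i `&` tdom j) (fun p => triv j p (f p (frame i a p)) 0 b).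

Definition dual_bundle E : bundle_data M := {|
  rk := rk E;
  fib := fun p => 'Hom(E p, R^o);
  triv_idx := triv_idx E;
  tdom := @tdom _ _ _ E;
  triv := fun i p => linfun (fun xi : 'Hom(E p, R^o) =>
    \row_a (xi (frame i a p) : R)) |}.

Definition sum_bundle E F : bundle_data M := {|
  rk := (rk E + rk F)%N;
  fib := fun p => (E p * F p)%type;
  triv_idx := (triv_idx E * triv_idx F)%type;
  tdom := fun ij => tdom ij.1 `&` tdom ij.2;
  triv := fun ij p => linfun (fun u : E p * F p =>
    row_mx (triv ij.1 p u.1) (triv ij.2 p u.2)) |}.

(* The tangent space at [p] is R^n through the coordinates of the chart
   [chart_at p]; in the chart [i] the coordinates of a tangent vector are
   obtained by applying the differential of the change of coordinates. *)
Definition tangent_bundle : bundle_data M := {|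
  rk := n;
  fib := fun _ => 'rV[R]_n;
  triv_idx := chart_idx M;
  tdom := @cdom _ _ M;
  triv := fun i p =>
    linfun ('d (chart i \o cinv (chart_at p)) (chart (chart_at p) p)) |}.

End Bundles.

Notation TM M := (@tangent_bundle _ _ M).
Notation TsM M := (dual_bundle (TM M)).

Record quadratic_lie_bundle (R : realType) (n : nat) (M : manifold R n) :=
  QuadraticLieBundle {
  qbundle :> bundle_data M;
  qbundleP : is_vbundle qbundle;
  qbr : forall p, qbundle p -> qbundle p -> qbundle p;
  qsp : forall p, qbundle p -> qbundle p -> R;
  qbr_linearl : forall p (s : qbundle p) (a : R) r r',
    qbr (a *: r + r') s = a *: qbr r s + qbr r' s;
  qbr_linearr : forall p (s : qbundle p) (a : R) r r',
    qbr s (a *: r + r') = a *: qbr s r + qbr s r';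
  qbr_alt : forall p (r : qbundle p), qbr r r = 0;
  qbr_jacobi : forall p (r s t : qbundle p),
    qbr r (qbr s t) + qbr s (qbr t r) + qbr t (qbr r s) = 0;
  qbr_smooth : forall (i j : triv_idx qbundle) a b c,
    smooth_fun (tdom i `&` tdom j)
      (fun p => triv j p (qbr (frame i a p) (frame i b p)) 0 c);
  qsp_sym : forall p (r s : qbundle p), qsp r s = qsp s r;
  qsp_linear : forall p (s : qbundle p) (a : R) r r',
    qsp s (a *: r + r') = a * qsp s r + qsp s r';
  qsp_nondeg : forall p (r : qbundle p), (forall s, qsp r s = 0) -> r = 0;
  qsp_invariant : forall p (r s t : qbundle p),
    qsp (qbr r s) t = qsp r (qbr s t);
  qsp_smooth : forall (i : triv_idx qbundle) a b,
    smooth_fun (tdom i) (fun p => qsp (frame i a p) (frame i b p))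
}.

(* [adjoint b c f] is the g with b (g w) v = c w (f v). It is used with
   non-degenerate pairings of finite-dimensional spaces, where it exists and is
   unique; the default value 0 is then never reached. *)
Definition adjoint (R : realType) (V V' W W' : vectType R)
    (b : V' -> V -> R) (c : W' -> W -> R) (f : 'Hom(V, W)) : 'Hom(W', V') :=
  xget 0 [set g : 'Hom(W', V') | forall w v, b (g w) v = c w (f v)].

Definition neutral_signature (R : realType) (V : vectType R)
    (b : V -> V -> R) : Prop :=
  exists P N : {vspace V},
    [/\ (P + N)%VS = fullv, (P :&: N)%VS = 0%VS, \dim P = \dim N,
        forall v, v \in P -> v != 0 -> 0 < b v v &
        forall v, v \in N -> v != 0 -> b v v < 0].

Section Courant.
Context {R : realType} {n : nat} {M : manifold R n}.
Variable G : quadratic_lie_bundle M.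

Definition courant : bundle_data M :=
  sum_bundle (sum_bundle (TM M) (TsM M)) G.

Definition courant_sp (p : M) (u v : courant p) : R :=
  2^-1 * ((v.1.2 u.1.1 : R) + (u.1.2 v.1.1 : R)) + qsp u.2 v.2.

Definition pair_cov p (xi : TsM M p) (X : TM M p) : R := xi X.
Definition pair_vec p (X : TM M p) (xi : TsM M p) : R := xi X.
Definition pair_2G p (r s : G p) : R := 2 * qsp r s.

Definition adj_J p (J : 'Hom(TM M p, TM M p)) : 'Hom(TsM M p, TsM M p) :=
  adjoint (@pair_cov p) (@pair_cov p) J.
Definition adj_B p (B : 'Hom(TsM M p, TM M p)) : 'Hom(TsM M p, TM M p) :=
  adjoint (@pair_vec p) (@pair_cov p) B.
Definition adj_A p (A : 'Hom(G p, G p)) : 'Hom(G p, G p) :=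
  adjoint (@qsp _ _ _ G p) (@qsp _ _ _ G p) A.
Definition adj_nu p (nu : 'Hom(TsM M p, G p)) : 'Hom(G p, TM M p) :=
  adjoint (@pair_vec p) (@pair_2G p) nu.
Definition adj_mu p (mu : 'Hom(TM M p, G p)) : 'Hom(G p, TsM M p) :=
  adjoint (@pair_cov p) (@pair_2G p) mu.

Record gen_acs := GenACS {
  gacs :> forall p, 'Hom(courant p, courant p);
  gacs_smooth : smooth_bmap (gacs : bmap courant courant);
  gacs_skew : forall p u v,
    courant_sp (gacs p u) v = - courant_sp u (gacs p v);
  gacs_square : forall p u, gacs p (gacs p u) = - u
}.

Definition gacs_nondegenerate (JJ : gen_acs) : Prop :=
  forall p, bijective (fun xi : TsM M p =>
    (JJ p ((0, xi), 0)).1.1 : TM M p).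

(* The endomorphism [JJ] has the block form
     ( J   B   -nu^* )
     ( C  -J^* -mu^* )
     ( mu  nu   A    )                                                      *)
Definition has_components (p : M) (JJ : 'Hom(courant p, courant p))
    (J : 'Hom(TM M p, TM M p)) (A : 'Hom(G p, G p))
    (B : 'Hom(TsM M p, TM M p)) (C : 'Hom(TM M p, TsM M p))
    (mu : 'Hom(TM M p, G p)) (nu : 'Hom(TsM M p, G p)) : Prop :=
  forall (X : TM M p) (xi : TsM M p) (r : G p),
    JJ ((X, xi), r) =
      ((J X + B xi - adj_nu nu r, C X - adj_J J xi - adj_mu mu r),
       mu X + nu xi + A r).

Record gacs_data := GacsData {
  dJ : bmap (TM M) (TM M);
  dA : bmap G G;
  dB : bmap (TsM M) (TM M);
  dnu : bmap (TsM M) G;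
  dJ_smooth : smooth_bmap dJ;
  dA_smooth : smooth_bmap dA;
  dB_smooth : smooth_bmap dB;
  dnu_smooth : smooth_bmap dnu;
  dB_bij : forall p, bijective (dB p);
  dB_skew : forall p, adj_B (dB p) = - dB p;
  dA_skew : forall p, adj_A (dA p) = - dA p;
  dA_square : forall p, (dA p \o dA p)%VF = - \1%VF;
  dJB : forall p, (dJ p \o dB p)%VF - (dB p \o adj_J (dJ p))%VF
                  = (adj_nu (dnu p) \o dnu p)%VF
}.

End Courant.

(* Main.v *)
Require Import Defs.
From HB Require Import structures.
From mathcomp Require Import all_boot all_order all_algebra.
From mathcomp Require Import boolp classical_sets functions cardinality.
From mathcomp Require Import reals topology normedtype derive landau.
From mathcomp Require Import lra.
Import Order.TTheory GRing.Theory Num.Theory.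
Import numFieldNormedType.Exports.
Local Open Scope classical_set_scope.
Local Open Scope ring_scope.
Set Implicit Arguments.
Unset Strict Implicit.
Unset Printing Implicit Defensive.

(** The idea is to read the structure in a splitting of [E] made of [T*M], of
    its image under the structure, and of the orthogonal complement of both.

    Let [F] be a non-degenerate generalised almost complex structure. On [T*M]
    it is [F xi = (B xi, - J* xi, nu xi)] (lemma [component_cotangent]).
    Because [B] is bijective, [T*M] and [F(T*M)] are complementary inside the
    subspace they span, and its orthogonal complement is the graph
    [{(0, B^-1 nu* r, r)}], a copy of [G]. The skew map [F] exchanges the first
    two summands, [F (F xi) = - xi], so it preserves the third one and acts
    there as an endomorphism of [G]: this is [At] ([component_normal]), and
    reading off the [G]-entry gives [At = A + nu B^-1 nu*]. The projection of
    the graph to [G] is an isometry, so [At] is skew with square [-1]. The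
    subspace [T*M] is isotropic and [F] preserves the scalar product, hence
    [F(T*M)] is isotropic too; this is the equation [J B - B J* = nu* nu]
    ([component_JB]).

    Conversely, let [J, At, B, nu] be given. The vectors [xi],
    [(B xi, - J* xi, nu xi)] and [(0, B^-1 nu* r, r)] span [E] ([splitting]), so
    at most one endomorphism acts on them by the three rules above
    ([adapted_unique]). The block matrix with the stated [A], [C], [mu] obeys
    these rules ([reconstruct_adapted]), which yields the formulas, and the
    rules make skew-symmetry and [F^2 = -1] immediate, because the scalar
    product in the splitting involves only [B] and the product of [G]
    ([courant_sp_splitting]).

    It remains to see that both directions preserve smoothness. In local frames
    the entries of all the maps involved are obtained from the given ones by
    sums, products and the inversion of the matrix of [B], so it is enough that
    smooth functions are stable under these operations and under division. *)

(** * Calculus of maps of class C^k *)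

Section Calculus.
Context {R : realType} {V W : normedModType R}.

(** The differential is a germ: the defining first-order expansion only sees
    values near the point. *)
Lemma near_eq_diff (f g : V -> W) (x : V) :
  {near x, f =1 g} -> differentiable f x ->
  differentiable g x /\ 'd g x = 'd f x :> (V -> W).
Proof.
move=> fg df.
have fx : g x = f x by rewrite (nbhs_singleton fg).
have dfc : continuous ('d f x) by exact: diff_continuous.
have gE : g \o shift x = cst (g x) + 'd f x +o_ 0 id.
  apply/eqaddoP => e e0.
  have [_ fE] := (diff_locallyP x f).1 df.
  have /eqaddoP/(_ e e0) fe := fE.
  have fg0 : \forall h \near 0, f (h + x) = g (h + x).
    rewrite (near_shift x) /=; apply: filterS fg => y.
    by rewrite /= sub0r addrNK.
  near=> h.
  have <- : (f \o shift x - (cst (f x) + 'd f x)) h =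
            (g \o shift x - (cst (g x) + 'd f x)) h.
    by rewrite !fctE /= fx; congr (_ - _); near: h.
  by near: h.
have dg := diff_unique dfc gE.
by split=> //; apply/diff_locallyP; rewrite dg.
Unshelve. all: by end_near. Qed.

Lemma Ck_on_continuous k (U : set V) (f : V -> W) :
  Ck_on k U f -> forall x, U x -> {for x, continuous f}.
Proof. by case: k => [//|k] [df _] x /df; exact: differentiable_continuous. Qed.

Lemma Ck_onW k (U : set V) (f : V -> W) : Ck_on k.+1 U f -> Ck_on k U f.
Proof.
elim: k f => [|k IH] f; first exact: Ck_on_continuous.
by case=> df Df; split=> // v; apply: IH; exact: Df.
Qed.

(** Being of class C^k on [U] is a condition on each point of [U] separately. *)
Lemma Ck_on_local k (U : set V) (f : V -> W) :
  (forall x, U x -> exists2 U', U' x & Ck_on k U' f) -> Ck_on k U f.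
Proof.
elim: k f => [|k IH] f loc.
  by move=> x /loc[U' U'x]; apply.
split; last move=> v.
  by move=> x /loc[U' U'x [df _]]; apply: df.
by apply: IH => x /loc[U' U'x [_ Df]]; exists U'; last exact: Df.
Qed.

(** Openness is essential: the conditions at a point of [U] involve the values
    of the function on a neighbourhood. *)
Lemma eq_Ck_on k (U : set V) (f g : V -> W) :
  open U -> {in U, f =1 g} -> Ck_on k U f -> Ck_on k U g.
Proof.
move=> oU; elim: k f g => [|k IH] f g fg.
  move=> cf x Ux.
  have fgx : {near x, f =1 g}.
    by near=> y; apply: fg; rewrite inE; near: y; exact: open_nbhs_nbhs.
  rewrite /prop_for /continuous_at -(fg x (mem_set Ux)).
  apply: cvg_trans (cf _ Ux); exact: near_eq_cvg.
have fgx x : U x -> {near x, f =1 g}.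
  move=> Ux; near=> y; apply: fg; rewrite inE; near: y.
  exact: open_nbhs_nbhs.
case=> df Df; split=> [x Ux|v].
  exact: (near_eq_diff (fgx _ Ux) (df _ Ux)).1.
apply: IH (Df v) => x /set_mem Ux; apply: near_eq_derive; exact: fgx.
Unshelve. all: by end_near. Qed.

Lemma Ck_on_cst k (U : set V) (c : W) : Ck_on k U (cst c).
Proof.
elim: k c => [|k IH] c /=; first by move=> x _; exact: cst_continuous.
split=> [x _|v]; first exact: differentiable_cst.
rewrite (_ : (fun x => _) = cst 0); first exact: IH.
by apply/funext => x; rewrite derive_cst.
Qed.

Lemma Ck_onD k (U : set V) (f g : V -> W) :
  open U -> Ck_on k U f -> Ck_on k U g -> Ck_on k U (f + g).
Proof.
move=> oU; elim: k f g => [|k IH] f g.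
  by move=> cf cg x Ux; apply: continuousD; [exact: cf|exact: cg].
case=> df Df [dg Dg]; split=> [x Ux|v].
  by apply: differentiableD; [exact: df|exact: dg].
apply: (eq_Ck_on oU _ (IH _ _ (Df v) (Dg v))) => x /set_mem Ux.
by rewrite deriveD //; apply: diff_derivable; [exact: df|exact: dg].
Qed.

End Calculus.

Section CalculusMul.
Context {R : realType} {V : normedModType R}.
Implicit Types (U : set V) (f g : V -> R^o).

(** Leibniz' rule, by induction on [k] for all factors at once, since the
    derivative of a product is again a sum of two products. *)
Lemma Ck_onM k U f g :
  open U -> Ck_on k U f -> Ck_on k U g -> Ck_on k U (fun x => f x * g x : R^o).
Proof.
move=> oU; elim: k f g => [|k IH] f g.
  by move=> cf cg x Ux; apply: continuousM; [exact: cf|exact: cg].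
move=> Cf Cg; have [Cf' Cg'] := (Ck_onW Cf, Ck_onW Cg).
case: Cf => df Df; case: Cg => dg Dg; split=> [x Ux|v].
  by apply: (@differentiableM _ _ f g); [exact: df|exact: dg].
apply: (eq_Ck_on oU _ (Ck_onD oU (IH _ _ Cf' (Dg v)) (IH _ _ Cg' (Df v)))).
move=> x /set_mem Ux; apply/esym.
by apply: (@deriveM _ _ f g); apply: diff_derivable; [exact: df|exact: dg].
Qed.

(** The derivative of [f^-1] is [- f^-1 * f^-1 * D f], where [f^-1] is of class
    C^k by induction, so the product rule applies. *)
Lemma Ck_onV k U f : open U -> (forall x, U x -> f x != 0) ->
  Ck_on k U f -> Ck_on k U (fun x => (f x)^-1 : R^o).
Proof.
move=> oU f0; elim: k => [|k IH] Cf.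
  by move=> x Ux; apply: continuousV; [exact: f0|exact: Cf].
have Cif := IH (Ck_onW Cf); case: Cf => df Df; split=> [x Ux|v].
  by apply: differentiableV; [exact: df|exact: f0].
(* Naming the scalar -1 at type R^o makes the constant factor a function with
   values in the normed module R^o. *)
pose N1 : R^o := -1.
apply: (eq_Ck_on oU _ (Ck_onM oU (Ck_onM oU (@Ck_on_cst _ _ R^o k U N1)
  (Ck_onM oU Cif Cif)) (Df v))) => x /set_mem Ux.
rewrite deriveV ?f0//; last exact/diff_derivable/df.
by rewrite /= /N1 mulN1r -exprVn expr2.
Qed.

End CalculusMul.

(** * Smooth functions on a manifold *)

Section SmoothFunctions.
Context {R : realType} {n : nat} {M : manifold R n}.
Implicit Types (U : set M) (f g : M -> R).

(** Smoothness is tested on these sets, and comparing two functions there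
    requires them to be open. *)
Lemma open_chart_image U i : open U -> open (chart i @` (U `&` cdom i)).
Proof.
move=> oU.
have -> : chart i @` (U `&` cdom i) =
    (chart i @` cdom i) `&` (cinv i @^-1` U).
  apply/seteqP; split=> [_ [p [Up ip] <-]|x [[p ip <-]]] /=.
    by split; [exists p|rewrite /= chartK].
  by rewrite chartK // => Up; exists p.
rewrite openE => x [ix Ux]; rewrite /interior; apply: filterI.
  by apply: open_nbhs_nbhs; split=> //; exact: cimg_open.
by apply: (cinv_continuous ix); apply: open_nbhs_nbhs.
Qed.

(** Smoothness is a pointwise condition, so to prove it on [U] one may shrink
    [U] around each point, for instance to the domain of an auxiliary local
    frame. *)
Lemma smooth_fun_local U f :
  (forall p, U p -> exists2 U', U' p & smooth_fun U' f) -> smooth_fun U f.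
Proof.
move=> loc i k; apply: Ck_on_local => _ [p [Up ip] <-].
have [U' U'p sf] := loc _ Up.
by exists (chart i @` (U' `&` cdom i)); [exists p|exact: sf].
Qed.

Lemma smooth_fun_sub U U' f : U `<=` U' -> smooth_fun U' f -> smooth_fun U f.
Proof. by move=> UU' sf; apply: smooth_fun_local => p /UU'; exists U'. Qed.

Lemma eq_smooth_fun U f g : open U -> (forall p, U p -> f p = g p) ->
  smooth_fun U f -> smooth_fun U g.
Proof.
move=> oU fg sf i k; apply: eq_Ck_on (sf i k); first exact: open_chart_image.
by move=> _ /set_mem[p [Up ip] <-] /=; rewrite chartK // fg.
Qed.

Lemma smooth_fun_cst U c : smooth_fun U (fun=> c).
Proof. by move=> i k; exact: Ck_on_cst. Qed.

Lemma smooth_funD U f g : open U -> smooth_fun U f -> smooth_fun U g ->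
  smooth_fun U (fun p => f p + g p).
Proof.
move=> oU sf sg i k; apply: Ck_onD (sf i k) (sg i k).
exact: open_chart_image.
Qed.

Lemma smooth_funM U f g : open U -> smooth_fun U f -> smooth_fun U g ->
  smooth_fun U (fun p => f p * g p).
Proof.
move=> oU sf sg i k; apply: Ck_onM (sf i k) (sg i k).
exact: open_chart_image.
Qed.

Lemma smooth_funV U f : open U -> (forall p, U p -> f p != 0) ->
  smooth_fun U f -> smooth_fun U (fun p => (f p)^-1).
Proof.
move=> oU f0 sf i k; apply: Ck_onV (sf i k); first exact: open_chart_image.
by move=> _ [p [Up ip] <-] /=; rewrite chartK // f0.
Qed.

Lemma smooth_fun_sum (I : Type) (r : seq I) (P : pred I) (F : I -> M -> R) U :
  open U -> (forall i, P i -> smooth_fun U (F i)) ->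
  smooth_fun U (fun p => \sum_(i <- r | P i) F i p).
Proof.
move=> oU sF; elim: r => [|i r IH].
  rewrite (_ : (fun p => _) = fun=> 0); first exact: smooth_fun_cst.
  by apply/funext => p; rewrite big_nil.
case: (boolP (P i)) => [Pi|/negbTE Pi].
  rewrite (_ : (fun p => _) = fun p => F i p + \sum_(j <- r | P j) F j p).
    by apply: smooth_funD => //; exact: sF.
  by apply/funext => p; rewrite big_cons Pi.
rewrite (_ : (fun p => _) = fun p => \sum_(j <- r | P j) F j p) //.
by apply/funext => p; rewrite big_cons Pi.
Qed.

Lemma smooth_fun_prod (I : Type) (r : seq I) (P : pred I) (F : I -> M -> R) U :
  open U -> (forall i, P i -> smooth_fun U (F i)) ->
  smooth_fun U (fun p => \prod_(i <- r | P i) F i p).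
Proof.
move=> oU sF; elim: r => [|i r IH].
  rewrite (_ : (fun p => _) = fun=> 1); first exact: smooth_fun_cst.
  by apply/funext => p; rewrite big_nil.
case: (boolP (P i)) => [Pi|/negbTE Pi].
  rewrite (_ : (fun p => _) = fun p => F i p * \prod_(j <- r | P j) F j p).
    by apply: smooth_funM => //; exact: sF.
  by apply/funext => p; rewrite big_cons Pi.
rewrite (_ : (fun p => _) = fun p => \prod_(j <- r | P j) F j p) //.
by apply/funext => p; rewrite big_cons Pi.
Qed.

Lemma smooth_fun_det m (A : M -> 'M[R]_m) U :
  open U -> (forall i j, smooth_fun U (fun p => A p i j)) ->
  smooth_fun U (fun p => \det (A p)).
Proof.
move=> oU sA; apply: smooth_fun_sum => // s _; apply: smooth_funM => //.
  exact: smooth_fun_cst.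
by apply: smooth_fun_prod.
Qed.

(** Cramer's rule. *)
Lemma smooth_fun_invmx m (A : M -> 'M[R]_m) U :
  open U -> (forall p, U p -> A p \in unitmx) ->
  (forall i j, smooth_fun U (fun p => A p i j)) ->
  forall i j, smooth_fun U (fun p => invmx (A p) i j).
Proof.
move=> oU uA sA i j.
apply: (@eq_smooth_fun _ (fun p => (\det (A p))^-1 *
    ((-1) ^+ (j + i) * \det (row' j (col' i (A p)))))) => //.
  by move=> p Up; rewrite /invmx uA // mxE [in RHS]mxE.
apply: smooth_funM => //.
  apply: smooth_funV => //; last exact: smooth_fun_det.
  by move=> p /uA; rewrite unitmxE unitfE.
apply: smooth_funM => //; first exact: smooth_fun_cst.
apply: smooth_fun_det => // a b.
rewrite (_ : (fun p => _) = fun p => A p (lift j a) (lift i b)) //.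
by apply/funext => p; rewrite !mxE.
Qed.

(** Two-sided inverses exist in equal dimensions only, so the matrices are
    square and Cramer's rule applies. *)
Lemma smooth_fun_mx_inverse m l (A : M -> 'M[R]_(m, l)) (N : M -> 'M[R]_(l, m))
    U :
  open U -> (forall p, U p -> A p *m N p = 1%:M /\ N p *m A p = 1%:M) ->
  (forall i j, smooth_fun U (fun p => A p i j)) ->
  forall i j, smooth_fun U (fun p => N p i j).
Proof.
move=> oU AN sA i j; apply: smooth_fun_local => p Up; exists U => //.
have [/mulmx1_min ml /mulmx1_min lm] := AN p Up.
have e : m = l by apply/anti_leq/andP.
case: _ / e A N AN sA i j {ml lm} => A N AN sA i j.
apply: (@eq_smooth_fun _ (fun p => invmx (A p) i j)) => //.
  move=> q /AN[ANq NAq]; have [uA _] := mulmx1_unit ANq.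
  by rewrite -[N q]mul1mx -(mulVmx uA) -mulmxA ANq mulmx1.
by apply: smooth_fun_invmx => // q /AN[/mulmx1_unit[]].
Qed.

End SmoothFunctions.

(** * Linear maps and local frames *)

Section LinearMaps.
Context {K : fieldType} {V W : vectType K}.

Lemma linfunE (f : V -> W) : linear f -> linfun f =1 f.
Proof.
move=> lf; pose mf := GRing.isLinear.Build K V W _ f lf.
pose ff : {linear V -> W} := HB.pack f mf; exact: (lfunE ff).
Qed.

Lemma lfun_invK (f : 'Hom(V, W)) : bijective f -> cancel f (f^-1)%VF.
Proof. by move=> /bij_inj/lker0P/lker0_lfunK. Qed.

Lemma lfun_invVK (f : 'Hom(V, W)) : bijective f -> cancel (f^-1)%VF f.
Proof.
by case=> g fK gK w; rewrite limg_lfunVK // -[w]gK memv_img // memvf.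
Qed.

End LinearMaps.

Section Frames.
Context {R : realType} {n : nat} {M : manifold R n}.
Implicit Types E F H : bundle_data M.

(** Local frames around every point, which is what is required in order to
    compute with bundle maps as with matrices. *)
Definition framed E : Prop :=
  [/\ forall i : triv_idx E, open (tdom i),
      forall p, exists i : triv_idx E, tdom i p &
      forall (i : triv_idx E) p, tdom i p -> bijective (triv i p)].

Lemma vbundle_framed E : is_vbundle E -> framed E.
Proof. by case. Qed.

Lemma triv_frame E (i : triv_idx E) a p :
  bijective (triv i p) -> triv i p (frame i a p) = delta_mx 0 a.
Proof. by move=> bi; rewrite /frame lfun_invVK. Qed.

Lemma frame_decomp E (i : triv_idx E) p (v : E p) : bijective (triv i p) ->
  v = \sum_a triv i p v 0 a *: frame i a p.
Proof.
move=> bi; apply: (bij_inj bi); rewrite linear_sum {1}[triv i p v]row_sum_delta.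
by apply: eq_bigr => a _; rewrite linearZ /= triv_frame.
Qed.

Lemma frame_unique E (i : triv_idx E) p a (v : E p) : bijective (triv i p) ->
  triv i p v = delta_mx 0 a -> frame i a p = v.
Proof. by move=> bi e; apply: (bij_inj bi); rewrite triv_frame. Qed.

(** A covector has as coordinates its values on the frame, so the frame of the
    dual bundle is the dual basis (lemma [dual_frameE]). *)
Lemma dual_trivE E (i : triv_idx E) p (xi : dual_bundle E p) a :
  triv (i : triv_idx (dual_bundle E)) p xi 0 a = xi (frame i a p).
Proof.
rewrite /= linfunE ?mxE // => c f g.
by apply/rowP => b; rewrite !mxE !lfunE /= !lfunE.
Qed.

Lemma dual_triv_bij E (i : triv_idx E) p : bijective (triv i p) ->
  bijective (triv (i : triv_idx (dual_bundle E)) p).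
Proof.
move=> bi; pose h (y : 'rV[R]_(rk E)) (v : E p) : R^o :=
  \sum_a triv i p v 0 a * y 0 a.
have lh y : linear (h y).
  move=> c u v; rewrite /h scaler_sumr -big_split /=; apply: eq_bigr => a _.
  by rewrite linearP !mxE mulrDl scalerAl.
exists (fun y => linfun (h y) : dual_bundle E p) => [xi|y].
  apply/lfunP => v; rewrite linfunE // {2}(frame_decomp v bi) linear_sum.
  by apply: eq_bigr => a _; rewrite dual_trivE linearZ.
apply/rowP => a; rewrite dual_trivE linfunE // /h triv_frame // (bigD1 a) //=.
rewrite mxE !eqxx mul1r big1 ?addr0 // => b ba.
by rewrite mxE (negbTE ba) andbF mul0r.
Qed.

Lemma dual_frameE E (i : triv_idx E) a p (v : E p) : bijective (triv i p) ->
  frame (i : triv_idx (dual_bundle E)) a p v = triv i p v 0 a.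
Proof.
move=> bi; rewrite [in LHS](frame_decomp v bi) linear_sum (bigD1 a) //=.
have db b : frame (i : triv_idx (dual_bundle E)) a p (frame i b p)
    = (b == a)%:R :> R.
  by rewrite -dual_trivE triv_frame ?mxE //; exact: dual_triv_bij.
rewrite linearZ /= db eqxx big1 => [|b /negbTE ba].
  by rewrite addr0 [_ *: _]mulr1.
by rewrite linearZ /= db ba [_ *: _]mulr0.
Qed.

Lemma framed_dual E : framed E -> framed (dual_bundle E).
Proof. by case=> oE cE bE; split=> // i p /bE; exact: dual_triv_bij. Qed.

Lemma sum_trivE E F (i : triv_idx E) (j : triv_idx F) p (u : sum_bundle E F p) :
  triv ((i, j) : triv_idx (sum_bundle E F)) p u
  = row_mx (triv i p u.1) (triv j p u.2).
Proof.
rewrite /= linfunE // => c x y.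
by rewrite /= !linearP scale_row_mx add_row_mx.
Qed.

Lemma sum_triv_bij E F (i : triv_idx E) (j : triv_idx F) p :
  bijective (triv i p) -> bijective (triv j p) ->
  bijective (triv ((i, j) : triv_idx (sum_bundle E F)) p).
Proof.
move=> bi bj.
exists (fun y => ((triv i p)^-1%VF (lsubmx y), (triv j p)^-1%VF (rsubmx y))).
  by case=> v w; rewrite sum_trivE row_mxKl row_mxKr /= !lfun_invK.
by move=> y; rewrite sum_trivE /= !lfun_invVK // hsubmxK.
Qed.

Lemma framed_sum E F : framed E -> framed F -> framed (sum_bundle E F).
Proof.
case=> oE cE bE [oF cF bF]; split=> [i|p|[i j] p [ip jp]].
- by apply: openI.
- by have [[i ip] [j jp]] := (cE p, cF p); exists (i, j).
- by apply: sum_triv_bij; [exact: bE|exact: bF].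
Qed.

Lemma frame_sumE E F (i : triv_idx E) (j : triv_idx F) p :
  bijective (triv i p) -> bijective (triv j p) ->
  (forall a, frame ((i, j) : triv_idx (sum_bundle E F)) (lshift _ a) p
     = (frame i a p, 0)) *
  (forall b, frame ((i, j) : triv_idx (sum_bundle E F)) (rshift _ b) p
     = (0, frame j b p)).
Proof.
move=> bi bj; split=> a; apply: frame_unique; first exact: sum_triv_bij.
- by rewrite sum_trivE /= triv_frame // linear0 delta_mx_lshift.
- exact: sum_triv_bij.
- by rewrite sum_trivE /= triv_frame // linear0 delta_mx_rshift.
Qed.

(** The two changes of coordinates are inverse to each other near the point, so
    the chain rule makes their differentials inverse to each other. *)
Lemma transition_diffK (i j : chart_idx M) (p : M) : cdom i p -> cdom j p ->
  cancel ('d (chart j \o cinv i) (chart i p) : 'rV[R]_n -> 'rV[R]_n)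
         ('d (chart i \o cinv j) (chart j p)).
Proof.
move=> ip jp v.
have dd (a b : chart_idx M) : cdom a p -> cdom b p ->
    differentiable (chart b \o cinv a) (chart a p).
  by move=> pa pb; apply: (transition_smooth a b 1%N).1; exists p.
have jpE : (chart j \o cinv i) (chart i p) = chart j p by rewrite /= chartK.
have dji : differentiable (chart i \o cinv j)
    ((chart j \o cinv i) (chart i p)) by rewrite jpE; exact: dd.
suff inv y : (chart j \o cinv i) (chart i p) = y ->
    'd (chart i \o cinv j) y ('d (chart j \o cinv i) (chart i p) v) = v.
  exact: inv.
move=> <-.
have /(congr1 (@^~ v)) /= <- := diff_comp (dd _ _ ip jp) dji.
have idE : {near chart i p,
    id =1 (chart i \o cinv j) \o (chart j \o cinv i)}.
  near=> x.
  have [q [iq jq] <-] : (chart i @` (cdom i `&` cdom j)) x.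
    near: x; apply: open_nbhs_nbhs; split; last by exists p.
    by rewrite setIC; apply: open_chart_image; exact: cdom_open.
  by rewrite /= !chartK.
have [_ ->] := near_eq_diff idE (@ex_diff _ _ _ _ _ _ _ (is_diff_id _)).
by rewrite diff_val.
Unshelve. all: by end_near. Qed.

(** A local trivialisation is the differential of a change of coordinates, with
    inverse the differential of the opposite change. *)
Lemma framed_tangent : framed (TM M).
Proof.
split=> [i|p|i p ip]; first exact: cdom_open.
  by exists (chart_at p); exact: chart_atP.
have jp := chart_atP p.
exists ('d (chart (chart_at p) \o cinv i) (chart i p)) => v.
  by rewrite /= lfunE; exact: transition_diffK.
by rewrite /= lfunE; exact: transition_diffK.
Qed.

End Frames.

(** * Smooth bundle maps *)

Section SmoothBundleMaps.
Context {R : realType} {n : nat} {M : manifold R n}.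
Implicit Types E F H : bundle_data M.

Lemma open_tdomI E F (i : triv_idx E) (j : triv_idx F) :
  framed E -> framed F -> open (tdom i `&` tdom j).
Proof. by case=> oE _ _ [oF _ _]; apply: openI. Qed.

Lemma smooth_bmapD E F (f g : bmap E F) : framed E -> framed F ->
  smooth_bmap f -> smooth_bmap g -> smooth_bmap (fun p => f p + g p).
Proof.
move=> fE fF sf sg i j a b; have oij := open_tdomI i j fE fF.
apply: eq_smooth_fun oij _ (smooth_funD oij (sf i j a b) (sg i j a b)).
by move=> p _; rewrite add_lfunE linearD mxE.
Qed.

Lemma smooth_bmapN E F (f : bmap E F) : framed E -> framed F ->
  smooth_bmap f -> smooth_bmap (fun p => - f p).
Proof.
move=> fE fF sf i j a b; have oij := open_tdomI i j fE fF.
apply: eq_smooth_fun oij _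
  (smooth_funM oij (smooth_fun_cst _ (-1)) (sf i j a b)).
by move=> p _; rewrite opp_lfunE linearN mxE mulN1r.
Qed.

(** In frames this is a product of matrices. The frame of [F] in the middle
    exists only locally, which suffices because smoothness is local. *)
Lemma smooth_bmap_comp E F H (g : bmap F H) (f : bmap E F) :
  framed E -> framed F -> framed H ->
  smooth_bmap g -> smooth_bmap f -> smooth_bmap (fun p => (g p \o f p)%VF).
Proof.
move=> fE [oF cF bF] [oH _ _] sg sf i k a c; have [oE _ _] := fE.
apply: smooth_fun_local => p [ip kp]; have [j jp] := cF p.
exists (tdom i `&` tdom j `&` tdom k); first by split.
have oijk : open (tdom i `&` tdom j `&` tdom k) by do !apply: openI.
apply: (@eq_smooth_fun _ _ _ _ (fun p => \sum_b
    triv j p (f p (frame i a p)) 0 b * triv k p (g p (frame j b p)) 0 c)) => //.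
  move=> q [[iq jq] kq].
  rewrite comp_lfunE [f q _ in RHS](frame_decomp _ (bF j q jq)).
  rewrite !linear_sum summxE.
  by apply: eq_bigr => b _; rewrite !linearZ /= mxE.
apply: smooth_fun_sum => // b _; apply: smooth_funM => //.
  by apply: smooth_fun_sub (sf i j a b) => q [[? ?] ?].
by apply: smooth_fun_sub (sg j k b c) => q [[? ?] ?]; split.
Qed.

(** The matrices of [f p] and of its inverse in two frames are inverse to each
    other, so the inversion of matrices applies. *)
Lemma smooth_bmap_inv E F (f : bmap E F) : framed E -> framed F ->
  (forall p, bijective (f p)) ->
  smooth_bmap f -> smooth_bmap (fun p => ((f p)^-1)%VF).
Proof.
move=> fE fF bf sf j i b a; have oji := open_tdomI j i fF fE.
have [[_ _ bE] [_ _ bF]] := (fE, fF).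
pose A p := \matrix_(a, b) triv j p (f p (frame i a p)) 0 b.
pose N p := \matrix_(b, a) triv i p ((f p)^-1%VF (frame j b p)) 0 a.
apply: (@eq_smooth_fun _ _ _ _ (fun p => N p b a)) => //.
  by move=> p _; rewrite mxE.
apply: (@smooth_fun_mx_inverse _ _ _ _ _ A N) => //.
  move=> p [jp ip]; split; apply/matrixP => c d; rewrite !mxE.
  - transitivity (triv i p ((f p)^-1%VF (f p (frame i c p))) 0 d); last first.
      by rewrite lfun_invK // triv_frame ?mxE 1?eq_sym//; exact: bE.
    rewrite [f p _ in RHS](frame_decomp _ (bF j p jp)) !linear_sum summxE.
    by apply: eq_bigr => e _; rewrite !linearZ /= !mxE.
  - transitivity (triv j p (f p ((f p)^-1%VF (frame j c p))) 0 d); last first.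
      by rewrite lfun_invVK // triv_frame ?mxE 1?eq_sym//; exact: bF.
    rewrite [_^-1%VF _ in RHS](frame_decomp _ (bE i p ip)) !linear_sum summxE.
    by apply: eq_bigr => e _; rewrite !linearZ /= !mxE.
move=> c d; apply: (eq_smooth_fun oji _
  (smooth_fun_sub _ (sf i j c d))) => [p _|p [? ?] //].
by rewrite mxE.
Qed.

Definition fst_lfun (V W : vectType R) : 'Hom((V * W)%type, V) := linfun fst.
Definition snd_lfun (V W : vectType R) : 'Hom((V * W)%type, W) := linfun snd.
Definition inl_lfun (V W : vectType R) : 'Hom(V, (V * W)%type) :=
  linfun (fun v => (v, 0)).
Definition inr_lfun (V W : vectType R) : 'Hom(W, (V * W)%type) :=
  linfun (fun w => (0, w)).

Lemma fst_lfunE (V W : vectType R) u : fst_lfun V W u = u.1.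
Proof. by rewrite lfunE. Qed.

Lemma snd_lfunE (V W : vectType R) u : snd_lfun V W u = u.2.
Proof. by rewrite lfunE. Qed.

Lemma inl_lfunE (V W : vectType R) v : inl_lfun V W v = (v, 0).
Proof.
rewrite linfunE // => c x y.
by rewrite -[c *: (x, 0) + _]/(_, c *: 0 + 0) scaler0 addr0.
Qed.

Lemma inr_lfunE (V W : vectType R) w : inr_lfun V W w = (0, w).
Proof.
rewrite linfunE // => c x y.
by rewrite -[c *: (0, x) + _]/(c *: 0 + 0, _) scaler0 addr0.
Qed.

(** A frame of the sum is the union of frames of the two summands
    ([frame_sumE]). For the direct implication, a frame of the other summand has
    to be chosen, which is possible around each point. *)
Lemma smooth_bmap_from_sum E F H (f : bmap (sum_bundle E F) H) :
  framed E -> framed F -> framed H ->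
  smooth_bmap f <->
  smooth_bmap (fun p => (f p \o inl_lfun (E p) (F p))%VF : 'Hom(E p, H p)) /\
  smooth_bmap (fun p => (f p \o inr_lfun (E p) (F p))%VF : 'Hom(F p, H p)).
Proof.
move=> fE fF [oH cH bH]; have [[oE cE bE] [oF cF bF]] := (fE, fF).
split=> [sf|[sl sr] [i j] k a c].
  split=> i k a c; apply: smooth_fun_local => p [ip kp].
  - have [j jp] := cF p; exists (tdom i `&` tdom j `&` tdom k) => //.
    apply: eq_smooth_fun (sf (i, j) k (lshift _ a) c).
      by do !apply: openI.
    move=> q [[iq jq] kq].
    by rewrite comp_lfunE inl_lfunE frame_sumE //; [exact: bE|exact: bF].
  - have [i' ip'] := cE p; exists (tdom i' `&` tdom i `&` tdom k) => //.
    apply: eq_smooth_fun (sf (i', i) k (rshift _ a) c).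
      by do !apply: openI.
    move=> q [[iq jq] kq].
    by rewrite comp_lfunE inr_lfunE frame_sumE //; [exact: bE|exact: bF].
have oijk : open (tdom i `&` tdom j `&` tdom k) by do !apply: openI.
case: (split_ordP a) => b ->.
- apply: (eq_smooth_fun oijk _ (smooth_fun_sub _ (sl i k b c))).
    move=> q [[iq jq] kq].
    by rewrite comp_lfunE inl_lfunE frame_sumE //; [exact: bE|exact: bF].
  by move=> q [[? ?] ?].
- apply: (eq_smooth_fun oijk _ (smooth_fun_sub _ (sr j k b c))).
    move=> q [[iq jq] kq].
    by rewrite comp_lfunE inr_lfunE frame_sumE //; [exact: bE|exact: bF].
  by move=> q [[? ?] ?].
Qed.

Lemma smooth_bmap_to_sum E F H (f : bmap H (sum_bundle E F)) :
  framed E -> framed F -> framed H ->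
  smooth_bmap f <->
  smooth_bmap (fun p => (fst_lfun (E p) (F p) \o f p)%VF : 'Hom(H p, E p)) /\
  smooth_bmap (fun p => (snd_lfun (E p) (F p) \o f p)%VF : 'Hom(H p, F p)).
Proof.
move=> fE fF [oH cH bH]; have [[oE cE bE] [oF cF bF]] := (fE, fF).
split=> [sf|[sl sr] k [i j] c a].
  split=> k i c a; apply: smooth_fun_local => p [kp ip].
  - have [j jp] := cF p; exists (tdom k `&` (tdom i `&` tdom j)) => //.
    apply: eq_smooth_fun (sf k (i, j) c (lshift _ a)).
      by do !apply: openI.
    by move=> q _; rewrite comp_lfunE fst_lfunE sum_trivE row_mxEl.
  - have [i' ip'] := cE p; exists (tdom k `&` (tdom i' `&` tdom i)) => //.
    apply: eq_smooth_fun (sf k (i', i) c (rshift _ a)).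
      by do !apply: openI.
    by move=> q _; rewrite comp_lfunE snd_lfunE sum_trivE row_mxEr.
have okij : open (tdom k `&` (tdom i `&` tdom j)) by do !apply: openI.
case: (split_ordP a) => b ->.
- apply: (eq_smooth_fun okij _ (smooth_fun_sub _ (sl k i c b))).
    by move=> q _; rewrite comp_lfunE fst_lfunE sum_trivE row_mxEl.
  by move=> q [? [? ?]].
- apply: (eq_smooth_fun okij _ (smooth_fun_sub _ (sr k j c b))).
    by move=> q _; rewrite comp_lfunE snd_lfunE sum_trivE row_mxEr.
  by move=> q [? [? ?]].
Qed.

End SmoothBundleMaps.

(** * Adjoints and their smoothness *)

Section Adjoints.
Context {R : realType} {V V' W W' : vectType R}.
Variables (b : V' -> V -> R) (c : W' -> W -> R).

(** The form [b] identifies [V'] with the dual of [V]: non-degeneracy on one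
    side and equality of dimensions are enough. *)
Definition perfect_pairing : Prop :=
  [/\ forall v', linear (b v' : V -> R^o),
      forall v, linear (b^~ v : V' -> R^o),
      forall v', (forall v, b v' v = 0) -> v' = 0 &
      dim V' = dim V].

Definition bilinear_pairing : Prop :=
  (forall w', linear (c w' : W -> R^o)) /\
  (forall w, linear (c^~ w : W' -> R^o)).

(** Since [b] is perfect, [v' |-> b v' _] is an isomorphism from [V'] to the
    dual of [V], and [g w] is the preimage of the functional [c w (f _)]. *)
Lemma adjointP (f : 'Hom(V, W)) : perfect_pairing -> bilinear_pairing ->
  forall w v, b (adjoint b c f w) v = c w (f v).
Proof.
case=> blr bll bnd bdim [clr cll].
pose flat := linfun (fun v' => linfun (b v' : V -> R^o)).
have flatE v' v : flat v' v = b v' v.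
  rewrite /flat linfunE; first by rewrite linfunE.
  move=> a x y; apply/lfunP => u.
  by rewrite add_lfunE scale_lfunE !linfunE // bll.
have ker0 : lker flat == 0%VS.
  apply/lker0P => x y xy; apply/subr0_eq/bnd => v.
  by rewrite -flatE linearB /= xy subrr lfunE.
have full : limg flat = fullv.
  apply/eqP; rewrite eqEdim subvf limg_dim_eq ?(eqP ker0) ?capv0 //.
  by rewrite !dimvf bdim; exact/eq_leq/muln1.
pose cf w := linfun (fun v => c w (f v) : R^o).
have cfE w v : cf w v = c w (f v).
  by rewrite /cf linfunE // => a x y; rewrite linearP; exact: clr.
suff : [set g : 'Hom(W', V') | forall w v, b (g w) v = c w (f v)]
         (adjoint b c f) by [].
apply: (@xgetPex _ 0); exists (linfun (fun w => (flat^-1)%VF (cf w))) => w v.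
rewrite linfunE => [|a x y]; last first.
  rewrite -linearP; congr (_ _); apply/lfunP => u.
  by rewrite add_lfunE scale_lfunE !cfE cll.
by rewrite -flatE limg_lfunVK ?full ?memvf // cfE.
Qed.

Lemma adjoint_unique (f : 'Hom(V, W)) (g : 'Hom(W', V')) :
  perfect_pairing -> bilinear_pairing ->
  (forall w v, b (g w) v = c w (f v)) -> adjoint b c f = g.
Proof.
move=> pb bc gE; apply/lfunP => w; have [_ bll bnd _] := pb.
apply/subr0_eq/bnd => v.
rewrite -scaleN1r addrC (bll v) /= gE adjointP //.
by rewrite [_ *: _]mulN1r addNr.
Qed.

End Adjoints.

Section CourantAdjoints.
Context {R : realType} {n : nat} {M : manifold R n}.
Variable G : quadratic_lie_bundle M.
Variable p : M.

Lemma pair_cov_perfect : perfect_pairing (@pair_cov R n M p).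
Proof.
split=> [xi a X Y|X a xi eta|xi xi0|]; rewrite /pair_cov.
- by rewrite linearP.
- by rewrite add_lfunE scale_lfunE.
- by apply/lfunP => X; rewrite zero_lfunE; exact: xi0.
- exact: muln1.
Qed.

Lemma pair_vec_perfect : perfect_pairing (@pair_vec R n M p).
Proof.
split=> [X a xi eta|xi a X Y|X X0|]; rewrite ?/pair_vec.
- by rewrite add_lfunE scale_lfunE.
- by rewrite linearP.
- apply/rowP => k; pose ck (v : 'rV[R]_n) : R^o := v 0 k.
  have lck : linear ck by move=> a u v; rewrite /ck !mxE.
  have := X0 (linfun ck : TsM M p).
  by rewrite /pair_vec linfunE // /ck mxE.
- exact/esym/muln1.
Qed.

Lemma qspDl (r r' s : G p) : qsp (r + r') s = qsp r s + qsp r' s.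
Proof.
rewrite qsp_sym -[r]scale1r qsp_linear mul1r scale1r.
by rewrite qsp_sym [qsp s r']qsp_sym.
Qed.

Lemma qspZl a (r s : G p) : qsp (a *: r) s = a * qsp r s.
Proof.
have q0 : qsp s 0 = 0.
  apply: (addrI (qsp s 0)).
  by rewrite -{1}[qsp s 0]mul1r -qsp_linear scale1r !addr0.
by rewrite qsp_sym -[a *: r]addr0 qsp_linear q0 addr0 qsp_sym.
Qed.

Lemma qspDr (r s s' : G p) : qsp r (s + s') = qsp r s + qsp r s'.
Proof. by rewrite ![qsp r _]qsp_sym qspDl. Qed.

Lemma qspZr a (r s : G p) : qsp r (a *: s) = a * qsp r s.
Proof. by rewrite ![qsp r _]qsp_sym qspZl. Qed.

Lemma qspNl (r s : G p) : qsp (- r) s = - qsp r s.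
Proof. by rewrite -scaleN1r qspZl mulN1r. Qed.

Lemma qspNr (r s : G p) : qsp r (- s) = - qsp r s.
Proof. by rewrite ![qsp r _]qsp_sym qspNl. Qed.

Lemma qsp_perfect : perfect_pairing (@qsp R n M G p).
Proof.
split=> [r a s s'|s a r r'|r|//]; last exact: qsp_nondeg.
- by rewrite qspDr qspZr.
- by rewrite qspDl qspZl.
Qed.

Lemma pair_2G_bilinear : bilinear_pairing (@pair_2G R n M G p).
Proof.
split=> [r a s s'|s a r r']; rewrite /pair_2G.
- by rewrite qspDr qspZr mulrDr mulrCA.
- by rewrite qspDl qspZl mulrDr mulrCA.
Qed.

Lemma perfect_bilinear (V V' : vectType R) (b : V' -> V -> R) :
  perfect_pairing b -> bilinear_pairing b.
Proof. by case. Qed.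

Lemma adj_JE (J : 'Hom(TM M p, TM M p)) (xi : TsM M p) (X : TM M p) :
  adj_J J xi X = xi (J X).
Proof.
exact: (adjointP J pair_cov_perfect (perfect_bilinear pair_cov_perfect)).
Qed.

Lemma adj_BE (B : 'Hom(TsM M p, TM M p)) (xi eta : TsM M p) :
  eta (adj_B B xi) = xi (B eta).
Proof.
exact: (adjointP B pair_vec_perfect (perfect_bilinear pair_cov_perfect)).
Qed.

Lemma adj_AE (A : 'Hom(G p, G p)) (r s : G p) :
  qsp (adj_A A r) s = qsp r (A s).
Proof. exact: (adjointP A qsp_perfect (perfect_bilinear qsp_perfect)). Qed.

Lemma adj_nuE (nu : 'Hom(TsM M p, G p)) (r : G p) (xi : TsM M p) :
  xi (adj_nu nu r) = 2 * qsp r (nu xi).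
Proof. exact: (adjointP nu pair_vec_perfect pair_2G_bilinear). Qed.

Lemma adj_muE (mu : 'Hom(TM M p, G p)) (r : G p) (X : TM M p) :
  adj_mu mu r X = 2 * qsp r (mu X).
Proof. exact: (adjointP mu pair_cov_perfect pair_2G_bilinear). Qed.

(** An operator with values in [TM] is determined by its pairings with
    covectors, because the pairing is perfect. *)
Lemma adj_B_skewP (B : 'Hom(TsM M p, TM M p)) :
  adj_B B = - B <-> forall xi eta : TsM M p, xi (B eta) = - eta (B xi).
Proof.
split=> [e xi eta|Bsk].
  by rewrite -adj_BE e opp_lfunE linearN.
apply: adjoint_unique pair_vec_perfect (perfect_bilinear pair_cov_perfect) _.
by move=> xi eta; rewrite /pair_vec /pair_cov Bsk opp_lfunE linearN.
Qed.

Lemma adj_A_skewP (A : 'Hom(G p, G p)) :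
  adj_A A = - A <-> forall r s : G p, qsp r (A s) = - qsp (A r) s.
Proof.
split=> [e r s|Ask].
  by rewrite -adj_AE e opp_lfunE qspNl.
apply: adjoint_unique qsp_perfect (perfect_bilinear qsp_perfect) _.
by move=> r s; rewrite Ask opp_lfunE qspNl.
Qed.

End CourantAdjoints.

Section SmoothAdjoints.
Context {R : realType} {n : nat} {M : manifold R n}.
Variable G : quadratic_lie_bundle M.

(** In dual frames the matrix of the adjoint is the transposed matrix. *)
Lemma smooth_adj_J (J : bmap (TM M) (TM M)) : smooth_bmap J ->
  smooth_bmap ((fun p => adj_J (J p)) : bmap (TsM M) (TsM M)).
Proof.
move=> sJ i j a b; have [oT _ bT] := @framed_tangent R n M.
have oij := openI (oT i) (oT j).
apply: eq_smooth_fun oij _ (smooth_fun_sub _ (sJ j i b a)); last first.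
  by move=> p [? ?]; split.
by move=> p [ip jp]; rewrite dual_trivE adj_JE dual_frameE //; exact: bT.
Qed.

(** The entries of [nu*] are [2 <e_a, nu e^b>], combinations of entries of [nu]
    with the Gram matrix [<e_a, e_c>] of the frame of [G], which is smooth. *)
Lemma smooth_adj_nu (nu : bmap (TsM M) G) : smooth_bmap nu ->
  smooth_bmap ((fun p => adj_nu (nu p)) : bmap G (TM M)).
Proof.
move=> snu i j a b; have [oT _ bT] := @framed_tangent R n M.
have [oG _ bG] := vbundle_framed (qbundleP G).
have oij := openI (oG i) (oT j).
apply: (@eq_smooth_fun _ _ _ _ (fun p => 2 * \sum_c
   triv i p (nu p (frame (j : triv_idx (TsM M)) b p)) 0 c *
   qsp (frame i a p) (frame i c p))) => // [p [ip jp]|].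
  rewrite -(dual_frameE _ _ (bT j p jp)) adj_nuE; congr (_ * _).
  rewrite [nu p _ in RHS](frame_decomp _ (bG i p ip)).
  elim/big_rec2: _ => [|c x y _ ->]; last by rewrite qspDr qspZr.
  by rewrite -[0 in RHS](scale0r 0) qspZr mul0r.
apply: smooth_funM => //; first exact: smooth_fun_cst.
apply: smooth_fun_sum => // c _; apply: smooth_funM => //.
  by apply: smooth_fun_sub (snu j i b c) => p [? ?]; split.
by apply: smooth_fun_sub (qsp_smooth i a c) => p [].
Qed.

Lemma smooth_adj_mu (mu : bmap (TM M) G) : smooth_bmap mu ->
  smooth_bmap ((fun p => adj_mu (mu p)) : bmap G (TsM M)).
Proof.
move=> smu i j a b; have [oT _ bT] := @framed_tangent R n M.
have [oG _ bG] := vbundle_framed (qbundleP G).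
have oij := openI (oG i) (oT j).
apply: (@eq_smooth_fun _ _ _ _ (fun p => 2 * \sum_c
   triv i p (mu p (frame (j : triv_idx (TM M)) b p)) 0 c *
   qsp (frame i a p) (frame i c p))) => // [p [ip jp]|].
  rewrite dual_trivE adj_muE; congr (_ * _).
  rewrite [mu p _ in RHS](frame_decomp _ (bG i p ip)).
  elim/big_rec2: _ => [|c x y _ ->]; last by rewrite qspDr qspZr.
  by rewrite -[0 in RHS](scale0r 0) qspZr mul0r.
apply: smooth_funM => //; first exact: smooth_fun_cst.
apply: smooth_fun_sum => // c _; apply: smooth_funM => //.
  by apply: smooth_fun_sub (smu j i b c) => p [? ?]; split.
by apply: smooth_fun_sub (qsp_smooth i a c) => p [].
Qed.

End SmoothAdjoints.

(** * The splitting defined by the data *)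

Definition pair_lfun (R : realType) (U V W : vectType R)
    (f : 'Hom(U, V)) (g : 'Hom(U, W)) : 'Hom(U, (V * W)%type) :=
  linfun (fun u => (f u, g u)).

Lemma pair_lfunE (R : realType) (U V W : vectType R)
    (f : 'Hom(U, V)) (g : 'Hom(U, W)) u : pair_lfun f g u = (f u, g u).
Proof. by rewrite linfunE // => a x y; rewrite !linearP. Qed.

Section Pointwise.
Context {R : realType} {n : nat} {M : manifold R n}.
Variable G : quadratic_lie_bundle M.
Variable p : M.

Local Notation V := (TM M p).
Local Notation Vs := (TsM M p).
Local Notation E := (courant G p).
Local Notation sp := (@courant_sp R n M G p).

Lemma courant_spC (u v : E) : sp u v = sp v u.
Proof. by rewrite /courant_sp qsp_sym [X in _ * X]addrC. Qed.

Definition vec_part : 'Hom(E, V) := linfun (fun u : E => u.1.1).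
Definition cov_part : 'Hom(E, Vs) := linfun (fun u : E => u.1.2).
Definition lie_part : 'Hom(E, G p) := linfun (fun u : E => u.2).

Lemma vec_partE u : vec_part u = u.1.1. Proof. by rewrite linfunE. Qed.
Lemma cov_partE u : cov_part u = u.1.2. Proof. by rewrite linfunE. Qed.
Lemma lie_partE u : lie_part u = u.2. Proof. by rewrite linfunE. Qed.
Definition partE := (vec_partE, cov_partE, lie_partE).

Definition block_endo (J : 'Hom(V, V)) (A : 'Hom(G p, G p)) (B : 'Hom(Vs, V))
    (C : 'Hom(V, Vs)) (mu : 'Hom(V, G p)) (nu : 'Hom(Vs, G p)) : 'Hom(E, E) :=
  pair_lfun
    (pair_lfun
      ((J \o vec_part) + (B \o cov_part) - (adj_nu nu \o lie_part))%VF
      ((C \o vec_part) - (adj_J J \o cov_part) - (adj_mu mu \o lie_part))%VF)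
    ((mu \o vec_part) + (nu \o cov_part) + (A \o lie_part))%VF.

Lemma block_endoE J A B C mu nu :
  has_components (block_endo J A B C mu nu) J A B C mu nu.
Proof.
move=> X xi r.
by rewrite /block_endo !pair_lfunE !(add_lfunE, opp_lfunE, comp_lfunE, partE).
Qed.

Definition cotangent_vec (xi : Vs) : E := ((0, xi), 0).

Section Splitting.
Variables (J : 'Hom(V, V)) (At : 'Hom(G p, G p)) (B : 'Hom(Vs, V))
  (nu : 'Hom(Vs, G p)).
Local Notation Binv := (B^-1)%VF.

Definition image_vec (xi : Vs) : E := ((B xi, - adj_J J xi), nu xi).
Definition normal_vec (r : G p) : E := ((0, Binv (adj_nu nu r)), r).

(** The three rules that characterise the structure with data
    [J, At, B, nu]: it exchanges [T*M] with [image_vec], and it acts by [At] on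
    their orthogonal complement, which is parametrised by [normal_vec]. *)
Definition adapted (F : 'Hom(E, E)) : Prop :=
  [/\ forall xi, F (cotangent_vec xi) = image_vec xi,
      forall xi, F (image_vec xi) = - cotangent_vec xi &
      forall r, F (normal_vec r) = normal_vec (At r)].

Hypothesis Bbij : bijective B.

(** The vector component determines [zeta = B^-1 X], then the [G]-component
    determines [r], and what is left is a covector. *)
Lemma splitting (u : E) : exists xi zeta r,
  u = cotangent_vec xi + image_vec zeta + normal_vec r.
Proof.
case: u => [[X eta] s]; pose zeta := Binv X; pose r := s - nu zeta.
exists (eta + adj_J J zeta - Binv (adj_nu nu r)), zeta, r.
congr ((_, _), _) => /=.
- by rewrite add0r addr0 lfun_invVK.
- by rewrite addrAC subrK addrK.
- by rewrite add0r addrC subrK.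
Qed.

Lemma adapted_unique (F F' : 'Hom(E, E)) : adapted F -> adapted F' -> F = F'.
Proof.
case=> Fc Fi Fn [Fc' Fi' Fn']; apply/lfunP => u.
have [xi [zeta [r ->]]] := splitting u.
by rewrite !linearD /= Fc Fi Fn Fc' Fi' Fn'.
Qed.

Lemma adapted_square (F : 'Hom(E, E)) : adapted F ->
  (forall r, At (At r) = - r) -> forall u, F (F u) = - u.
Proof.
case=> Fc Fi Fn AA u; have [xi [zeta [r ->]]] := splitting u.
have FN x : F (- x) = - F x by rewrite linearN.
rewrite !linearD /= Fc !Fi !Fn FN Fc AA.
congr (_ + _); congr ((_, _), _); first by rewrite oppr0.
by rewrite !linearN.
Qed.

Hypothesis Bskew : forall xi eta : Vs, xi (B eta) = - eta (B xi).

(** At [X = B xi] this is the orthogonality of [normal_vec r] and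
    [image_vec xi]. *)
Lemma inv_adj_nuE (r : G p) (X : V) :
  Binv (adj_nu nu r) X = - (2 * qsp r (nu (Binv X))).
Proof.
rewrite -{1}[X](lfun_invVK Bbij) [LHS]Bskew (lfun_invVK Bbij).
by rewrite adj_nuE.
Qed.

Hypothesis JB : forall xi, J (B xi) - B (adj_J J xi) = adj_nu nu (nu xi).

(** The equation [J B - B J* = nu* nu] says exactly that the vectors
    [image_vec] span an isotropic subspace; see [courant_sp_splitting]. *)
Lemma image_isotropic (b b' : Vs) :
  b' (J (B b)) + b (J (B b')) = 2 * qsp (nu b) (nu b').
Proof.
have -> : J (B b) = adj_nu nu (nu b) + B (adj_J J b) by rewrite -JB subrK.
by rewrite linearD /= adj_nuE Bskew adj_JE addrNK.
Qed.

(** In the splitting the scalar product is the pairing of the two isotropic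
    summands through [B], plus the scalar product of [G]; [J] and [nu] have
    disappeared. *)
Lemma courant_sp_splitting (a b a' b' : Vs) (r r' : G p) :
  sp (cotangent_vec a + image_vec b + normal_vec r)
     (cotangent_vec a' + image_vec b' + normal_vec r')
  = 2^-1 * (a' (B b) + a (B b')) + qsp r r'.
Proof.
rewrite /courant_sp /= !add0r !addr0 !add_lfunE !opp_lfunE !adj_JE !inv_adj_nuE.
rewrite !(lfun_invK Bbij) !(qspDl, qspDr) [qsp (nu b) r']qsp_sym.
have := image_isotropic b b'.
lra.
Qed.

(** By the shape of the scalar product in the splitting, it comes down to the
    skewness of [B] and of [At]. *)
Lemma adapted_skew (F : 'Hom(E, E)) : adapted F ->
  (forall r s, qsp r (At s) = - qsp (At r) s) ->
  forall u v, sp (F u) v = - sp u (F v).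
Proof.
case=> Fc Fi Fn Ask u v.
have [a [b [r ->]]] := splitting u; have [a' [b' [r' ->]]] := splitting v.
have FE x y s : F (cotangent_vec x + image_vec y + normal_vec s) =
    cotangent_vec (- y) + image_vec x + normal_vec (At s).
  rewrite !linearD /= Fc Fi Fn; congr (_ + _); rewrite addrC; congr (_ + _).
  by congr ((_, _), _); rewrite oppr0.
rewrite !FE !courant_sp_splitting !opp_lfunE Ask (Bskew b b') (Bskew a a').
lra.
Qed.

Definition data_A : 'Hom(G p, G p) :=
  (At - (nu \o Binv \o adj_nu nu))%VF.

Definition data_C : 'Hom(V, Vs) :=
  (- (Binv \o ((adj_nu nu \o At \o nu \o Binv) + \1))
     - (adj_J J \o Binv \o J))%VF.

Definition data_mu : 'Hom(V, G p) :=
  ((nu \o Binv \o J) - (At \o nu \o Binv))%VF.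

Definition reconstruct : 'Hom(E, E) :=
  block_endo J data_A B data_C data_mu nu.

(** Skewness of [At] and of [B^-1] turns the adjoint of [nu B^-1 J - At nu B^-1]
    into [- J* B^-1 nu* - B^-1 nu* At]. *)
Lemma adj_data_muE (r : G p) : (forall r s, qsp r (At s) = - qsp (At r) s) ->
  adj_mu data_mu r =
  - (adj_J J (Binv (adj_nu nu r)) + Binv (adj_nu nu (At r))).
Proof.
move=> Ask; apply/lfunP => X.
rewrite opp_lfunE add_lfunE adj_JE !inv_adj_nuE adj_muE.
rewrite add_lfunE opp_lfunE !comp_lfunE qspDr qspNr Ask.
lra.
Qed.

(** A computation in the free algebra on the data, once [B^-1 J B] is replaced
    by [J* + B^-1 nu* nu]. *)
Lemma reconstruct_adapted :
  (forall r s, qsp r (At s) = - qsp (At r) s) -> adapted reconstruct.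
Proof.
move=> Ask.
have JBE xi : Binv (J (B xi)) = adj_J J xi + Binv (adj_nu nu (nu xi)).
  by rewrite -JB linearB /= (lfun_invK Bbij) addrC subrK.
split=> [xi|xi|r]; rewrite block_endoE.
- by rewrite !linear0 !(add0r, addr0, subr0).
- rewrite -[- cotangent_vec xi]/((- 0, - xi), - 0) oppr0.
  congr ((_, _), _).
  + by rewrite [B (- _)]linearN /= JB subrr oppr0.
  + rewrite adj_data_muE // /data_C.
    rewrite !(add_lfunE, opp_lfunE, comp_lfunE, lfunE) /=.
    rewrite !(lfun_invK Bbij) JBE [Binv (_ + _)]linearD /= (lfun_invK Bbij).
    rewrite [adj_J J (_ + _)]linearD [adj_J J (- _)]linearN /= !opprK.
    set jnu := adj_J J (Binv _).
    rewrite [- (_ + jnu)]opprD !addrA [X in X + _ + _]addrAC !subrK.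
    by rewrite opprD addrAC addNr add0r.
  + rewrite /data_mu /data_A !(add_lfunE, opp_lfunE, comp_lfunE) JBE.
    rewrite !(lfun_invK Bbij) [nu (_ + _)]linearD [nu (- _)]linearN /=.
    rewrite addrA [X in X - _]addrAC subrK [X in X - _ - _]addrC addrK.
    by rewrite subrr.
- congr ((_, _), _).
  + by rewrite linear0 add0r (lfun_invVK Bbij) subrr.
  + by rewrite linear0 add0r adj_data_muE // opprK addKr.
  + rewrite linear0 add0r /data_A !(add_lfunE, opp_lfunE, comp_lfunE).
    by rewrite addrC subrK.
Qed.

End Splitting.
End Pointwise.

(** * From a structure to the data *)

Section ComponentsOfStructure.
Context {R : realType} {n : nat} {M : manifold R n}.
Variable G : quadratic_lie_bundle M.
Variable p : M.

Local Notation V := (TM M p).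
Local Notation Vs := (TsM M p).
Local Notation E := (courant G p).
Local Notation sp := (@courant_sp R n M G p).

Definition vec_incl : 'Hom(V, E) := linfun (fun X : V => ((X, 0), 0) : E).
Definition cov_incl : 'Hom(Vs, E) := linfun (fun xi : Vs => ((0, xi), 0) : E).
Definition lie_incl : 'Hom(G p, E) := linfun (fun r : G p => ((0, 0), r) : E).

Lemma pair_scaleD (V1 V2 : vectType R) a (u v : (V1 * V2)%type) :
  a *: u + v = (a *: u.1 + v.1, a *: u.2 + v.2).
Proof. by []. Qed.

Lemma vec_inclE X : vec_incl X = ((X, 0), 0).
Proof.
rewrite linfunE // => a u v.
by rewrite !pair_scaleD /= !scaler0 !addr0.
Qed.

Lemma cov_inclE xi : cov_incl xi = ((0, xi), 0).
Proof.
rewrite linfunE // => a u v.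
by rewrite !pair_scaleD /= !scaler0 !addr0.
Qed.

Lemma lie_inclE r : lie_incl r = ((0, 0), r).
Proof.
rewrite linfunE // => a u v.
by rewrite !pair_scaleD /= !scaler0 !addr0.
Qed.

Definition inclE := (vec_inclE, cov_inclE, lie_inclE).

Variable F : 'Hom(E, E).

Definition component_J : 'Hom(V, V) := (vec_part G p \o F \o vec_incl)%VF.
Definition component_B : 'Hom(Vs, V) := (vec_part G p \o F \o cov_incl)%VF.
Definition component_nu : 'Hom(Vs, G p) := (lie_part G p \o F \o cov_incl)%VF.
Definition component_A : 'Hom(G p, G p) := (lie_part G p \o F \o lie_incl)%VF.

(** The action of [F] on the orthogonal complement of [T*M + F(T*M)], read in
    [G]; see [component_normal]. *)
Definition component_At : 'Hom(G p, G p) :=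
  (component_A + (component_nu \o component_B^-1 \o adj_nu component_nu))%VF.

Local Notation J := component_J.
Local Notation B := component_B.
Local Notation nu := component_nu.
Local Notation A := component_A.
Local Notation At := component_At.

Lemma component_JE X : J X = (F ((X, 0), 0)).1.1.
Proof. by rewrite !comp_lfunE partE inclE. Qed.
Lemma component_BE xi : B xi = (F ((0, xi), 0)).1.1.
Proof. by rewrite !comp_lfunE partE inclE. Qed.
Lemma component_nuE xi : nu xi = (F ((0, xi), 0)).2.
Proof. by rewrite !comp_lfunE partE inclE. Qed.
Lemma component_AE r : A r = (F ((0, 0), r)).2.
Proof. by rewrite !comp_lfunE partE inclE. Qed.

Lemma component_AtE r :
  At r = A r + nu ((B^-1)%VF (adj_nu nu r)).
Proof. by rewrite add_lfunE; congr (_ + _); rewrite !comp_lfunE. Qed.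

Hypothesis Fskew : forall u v, sp (F u) v = - sp u (F v).
Hypothesis Fsq : forall u, F (F u) = - u.
Hypothesis Fnd : bijective (fun xi : Vs => (F ((0, xi), 0)).1.1 : V).

Lemma component_B_bij : bijective B.
Proof. by apply: (eq_bij Fnd) => xi; rewrite component_BE. Qed.

Lemma qsp0l (r : G p) : qsp 0 r = 0.
Proof. by rewrite -[0 in LHS](scale0r 0) qspZl mul0r. Qed.
Lemma qsp0r (r : G p) : qsp r 0 = 0.
Proof. by rewrite qsp_sym qsp0l. Qed.

Lemma sp_cotangent (u : E) xi : sp u (cotangent_vec G xi) = 2^-1 * xi u.1.1.
Proof. by rewrite /courant_sp /= linear0 addr0 qsp0r addr0. Qed.

Lemma half_inj (x y : R) : 2^-1 * x = 2^-1 * y -> x = y.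
Proof. by apply: mulfI; rewrite invr_eq0 pnatr_eq0. Qed.

(** The covector entry comes from skewness, tested against tangent vectors. *)
Lemma component_cotangent xi :
  F (cotangent_vec G xi) = image_vec J B nu xi.
Proof.
rewrite [LHS]surjective_pairing [(F _).1]surjective_pairing.
rewrite /image_vec component_BE component_nuE; congr ((_, _), _).
apply/lfunP => X; apply: half_inj.
transitivity (sp (F (cotangent_vec G xi)) ((X, 0), 0)).
  by rewrite /courant_sp /= zero_lfunE add0r qsp0r addr0.
rewrite Fskew courant_spC sp_cotangent opp_lfunE adj_JE component_JE.
by rewrite mulrN.
Qed.

Lemma component_B_skew (xi eta : Vs) : xi (B eta) = - eta (B xi).
Proof.
apply: half_inj; rewrite mulrN !component_BE -!sp_cotangent Fskew.
by rewrite courant_spC.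
Qed.

(** [T*M] is isotropic and [F] preserves the scalar product, as a skew map with
    square [-1], so [F(T*M)] is isotropic. *)
Lemma component_JB xi :
  J (B xi) - B (adj_J J xi) = adj_nu nu (nu xi).
Proof.
have [_ _ nd _] := @pair_vec_perfect R n M p.
apply/subr0_eq/nd => eta; rewrite /pair_vec.
have : sp (image_vec J B nu xi) (image_vec J B nu eta) = 0.
  rewrite -!component_cotangent Fskew Fsq courant_spC.
  by rewrite sp_cotangent /= oppr0 linear0 mulr0 oppr0.
rewrite /courant_sp /= !opp_lfunE !adj_JE !linearD !linearN /= adj_nuE.
rewrite (component_B_skew eta) adj_JE.
lra.
Qed.

(** A vector [normal_vec r] is orthogonal to the [F]-invariant subspace
    [T*M + F(T*M)], hence so is its image under the skew map [F]. Orthogonality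
    to [T*M] kills the vector entry, and orthogonality to [F(T*M)] then
    determines the covector entry from the [G]-entry. *)
Lemma component_normal r : F (normal_vec B nu r) =
  normal_vec B nu (At r).
Proof.
have Bb := component_B_bij.
have invE := inv_adj_nuE nu Bb component_B_skew.
pose N := normal_vec B nu.
have s2 : (F (N r)).2 = At r.
  have -> : N r = cotangent_vec G ((B^-1)%VF (adj_nu nu r)) + ((0, 0), r).
    rewrite /N /normal_vec /cotangent_vec.
    by congr ((_, _), _); rewrite ?addr0 ?add0r.
  by rewrite linearD /= component_AtE component_AE component_nuE addrC.
have spNi s xi : sp (N s) (image_vec J B nu xi) = 0.
  rewrite /courant_sp /= linear0 add0r invE (lfun_invK Bb).
  lra.
(* Orthogonality of the image to T*M, then to F(T*M). *)
have s11 : (F (N r)).1.1 = 0.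
  have [_ _ nd _] := @pair_vec_perfect R n M p.
  apply: nd => xi; rewrite /pair_vec; apply: half_inj.
  by rewrite -sp_cotangent Fskew component_cotangent spNi oppr0 mulr0.
have s12 : (F (N r)).1.2 = (B^-1)%VF (adj_nu nu (At r)).
  apply/lfunP => X; rewrite -[X](lfun_invVK Bb); set xi := (_^-1)%VF X.
  rewrite invE (lfun_invK Bb).
  have : sp (F (N r)) (image_vec J B nu xi) = 0.
    rewrite Fskew -component_cotangent Fsq courant_spC /courant_sp /=.
    by rewrite !oppr0 !linear0 addr0 mulr0 qsp0l addr0 oppr0.
  rewrite /courant_sp /= s11 s2 linear0 add0r => h.
  by apply: half_inj; lra.
rewrite -/(N r) [LHS]surjective_pairing [(F (N r)).1]surjective_pairing.
by rewrite s2 s11 s12.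
Qed.

Lemma component_adapted : adapted J At B nu F.
Proof.
split; [exact: component_cotangent| |exact: component_normal].
by move=> xi; rewrite -component_cotangent Fsq.
Qed.

(** [normal_vec] is injective, so the rule [F^2 = -1] descends to [At]. *)
Lemma component_At_sq r : At (At r) = - r.
Proof.
have := congr1 snd (Fsq (normal_vec B nu r)).
by rewrite !component_normal.
Qed.

(** [normal_vec] is an isometric embedding of [G], because covectors are
    orthogonal to each other. *)
Lemma component_At_skew r s : qsp r (At s) = - qsp (At r) s.
Proof.
have := Fskew (normal_vec B nu r) (normal_vec B nu s).
rewrite !component_normal /courant_sp /= !linear0 !add0r !mulr0 !add0r => ->.
by rewrite opprK.
Qed.

End ComponentsOfStructure.

(** * The bijection *)

Section Bijection.
Context {R : realType} {n : nat} {M : manifold R n}.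
Variable G : quadratic_lie_bundle M.

Let fT : framed (TM M) := @framed_tangent R n M.
Let fTs : framed (TsM M) := framed_dual fT.
Let fG : framed G := vbundle_framed (qbundleP G).
Let fTT : framed (sum_bundle (TM M) (TsM M)) := framed_sum fT fTs.
Let fE : framed (courant G) := framed_sum fTT fG.

Lemma smooth_eq (E F : bundle_data M) (f g : bmap E F) :
  (forall p u, f p u = g p u) -> smooth_bmap f <-> smooth_bmap g.
Proof.
move=> fg; rewrite (_ : g = f) //.
by apply/functional_extensionality_dep => p; apply/lfunP => u; rewrite fg.
Qed.

Lemma smooth_to_courant (E : bundle_data M) (f : bmap E (courant G)) :
  framed E ->
  smooth_bmap f <->
  [/\ smooth_bmap ((fun p => vec_part G p \o f p)%VF : bmap E (TM M)),
      smooth_bmap ((fun p => cov_part G p \o f p)%VF : bmap E (TsM M)) &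
      smooth_bmap ((fun p => lie_part G p \o f p)%VF : bmap E G)].
Proof.
move=> fE'; rewrite (smooth_bmap_to_sum _ fTT fG fE').
rewrite (smooth_bmap_to_sum _ fT fTs fE').
have e1 : smooth_bmap
      ((fun p => fst_lfun _ _ \o (fst_lfun _ _ \o f p))%VF : bmap E (TM M)) <->
    smooth_bmap ((fun p => vec_part G p \o f p)%VF : bmap E (TM M)).
  apply: smooth_eq => p u; rewrite !comp_lfunE partE fst_lfunE; congr (_.1).
  exact: fst_lfunE.
have e2 : smooth_bmap
      ((fun p => snd_lfun _ _ \o (fst_lfun _ _ \o f p))%VF : bmap E (TsM M)) <->
    smooth_bmap ((fun p => cov_part G p \o f p)%VF : bmap E (TsM M)).
  apply: smooth_eq => p u; rewrite !comp_lfunE partE snd_lfunE; congr (_.2).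
  exact: fst_lfunE.
have e3 : smooth_bmap ((fun p => snd_lfun _ _ \o f p)%VF : bmap E G) <->
    smooth_bmap ((fun p => lie_part G p \o f p)%VF : bmap E G).
  by apply: smooth_eq => p u; rewrite !comp_lfunE partE.
by split=> [[[/e1 ? /e2 ?] /e3 ?]|[/e1 ? /e2 ? /e3 ?]].
Qed.

Lemma smooth_from_courant (H : bundle_data M) (f : bmap (courant G) H) :
  framed H ->
  smooth_bmap f <->
  [/\ smooth_bmap ((fun p => f p \o vec_incl G p)%VF : bmap (TM M) H),
      smooth_bmap ((fun p => f p \o cov_incl G p)%VF : bmap (TsM M) H) &
      smooth_bmap ((fun p => f p \o lie_incl G p)%VF : bmap G H)].
Proof.
move=> fH; rewrite (smooth_bmap_from_sum _ fTT fG fH).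
rewrite (smooth_bmap_from_sum _ fT fTs fH).
have e1 : smooth_bmap
      ((fun p => (f p \o inl_lfun _ _) \o inl_lfun _ _)%VF : bmap (TM M) H) <->
    smooth_bmap ((fun p => f p \o vec_incl G p)%VF : bmap (TM M) H).
  apply: smooth_eq => p u; rewrite !comp_lfunE inclE; congr (f p _).
  by rewrite -[RHS](inl_lfunE (G p) (u, 0)); congr (_ _); exact: inl_lfunE.
have e2 : smooth_bmap
      ((fun p => (f p \o inl_lfun _ _) \o inr_lfun _ _)%VF : bmap (TsM M) H) <->
    smooth_bmap ((fun p => f p \o cov_incl G p)%VF : bmap (TsM M) H).
  apply: smooth_eq => p u; rewrite !comp_lfunE inclE; congr (f p _).
  by rewrite -[RHS](inl_lfunE (G p) (0, u)); congr (_ _); exact: inr_lfunE.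
have e3 : smooth_bmap ((fun p => f p \o inr_lfun _ _)%VF : bmap G H) <->
    smooth_bmap ((fun p => f p \o lie_incl G p)%VF : bmap G H).
  by apply: smooth_eq => p u; rewrite !comp_lfunE inclE; congr (f p _);
     exact: inr_lfunE.
by split=> [[[/e1 ? /e2 ?] /e3 ?]|[/e1 ? /e2 ? /e3 ?]].
Qed.

Lemma smooth_blocks (F : bmap (courant G) (courant G)) (J : bmap (TM M) (TM M))
    (A : bmap G G) (B : bmap (TsM M) (TM M)) (C : bmap (TM M) (TsM M))
    (mu : bmap (TM M) G) (nu : bmap (TsM M) G) :
  (forall p, has_components (F p) (J p) (A p) (B p) (C p) (mu p) (nu p)) ->
  smooth_bmap J -> smooth_bmap A -> smooth_bmap B -> smooth_bmap C ->
  smooth_bmap mu -> smooth_bmap nu -> smooth_bmap F.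
Proof.
move=> FE sJ sA sB sC smu snu; apply/(smooth_from_courant _ fE).
split; apply/smooth_to_courant => //; split.
- apply: (smooth_eq _).1 sJ => p X.
  by rewrite !comp_lfunE partE inclE FE /= !linear0 ?add0r ?addr0.
- apply: (smooth_eq _).1 sC => p X.
  by rewrite !comp_lfunE partE inclE FE /= !linear0 ?add0r ?addr0.
- apply: (smooth_eq _).1 smu => p X.
  by rewrite !comp_lfunE partE inclE FE /= !linear0 ?add0r ?addr0.
- apply: (smooth_eq _).1 sB => p X.
  by rewrite !comp_lfunE partE inclE FE /= !linear0 ?add0r ?addr0.
- apply: (smooth_eq _).1 (smooth_bmapN fTs fTs (smooth_adj_J sJ)) => p X.
  by rewrite !comp_lfunE partE inclE FE /= !linear0 ?add0r ?addr0 opp_lfunE.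
- apply: (smooth_eq _).1 snu => p X.
  by rewrite !comp_lfunE partE inclE FE /= !linear0 ?add0r ?addr0.
- apply: (smooth_eq _).1 (smooth_bmapN fG fT (smooth_adj_nu snu)) => p X.
  by rewrite !comp_lfunE partE inclE FE /= !linear0 ?add0r ?addr0 opp_lfunE.
- apply: (smooth_eq _).1 (smooth_bmapN fG fTs (smooth_adj_mu smu)) => p X.
  by rewrite !comp_lfunE partE inclE FE /= !linear0 ?add0r ?addr0 opp_lfunE.
- apply: (smooth_eq _).1 sA => p X.
  by rewrite !comp_lfunE partE inclE FE /= !linear0 ?add0r ?addr0.
Qed.

Lemma smooth_reconstruct (d : gacs_data G) : smooth_bmap
  ((fun p => reconstruct (dJ d p) (dA d p) (dB d p) (dnu d p))
     : bmap (courant G) (courant G)).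
Proof.
have [sJ sAt] := (@dJ_smooth _ _ _ _ d, @dA_smooth _ _ _ _ d).
have [sB snu] := (@dB_smooth _ _ _ _ d, @dnu_smooth _ _ _ _ d).
have sBi := smooth_bmap_inv fTs fT (@dB_bij _ _ _ _ d) sB.
have sns := smooth_adj_nu snu.
have snuB := smooth_bmap_comp fT fTs fG snu sBi.
have sAnB := smooth_bmap_comp fT fG fG sAt snuB.
have sBJ := smooth_bmap_comp fT fT fTs sBi sJ.
apply: (smooth_blocks (fun p => block_endoE _ _ _ _ _ _)) => //.
- have := smooth_bmapD fG fG sAt
    (smooth_bmapN fG fG (smooth_bmap_comp fG fT fG snuB sns)).
  by apply: (smooth_eq _).1 => p u; rewrite /data_A.
- have := smooth_bmapD fT fTs (smooth_bmapN fT fTs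
      (smooth_bmapD fT fTs (smooth_bmap_comp fT fT fTs sBi
          (smooth_bmap_comp fT fG fT sns sAnB)) sBi))
      (smooth_bmapN fT fTs (smooth_bmap_comp fT fTs fTs (smooth_adj_J sJ) sBJ)).
  apply: (smooth_eq _).1 => p u.
  (* Distributing B^-1 over the sum removes the identity of TM, whose smoothness
     would amount to that of the transition functions. *)
  by rewrite /data_C comp_lfunDr comp_lfun1r !comp_lfunA.
- have := smooth_bmapD fT fG (smooth_bmap_comp fT fTs fG snu sBJ)
    (smooth_bmapN fT fG sAnB).
  by apply: (smooth_eq _).1 => p u; rewrite /data_mu !comp_lfunA.
Qed.

Lemma gen_acs_eq (F F' : gen_acs G) : (forall p, F p = F' p) -> F = F'.
Proof.
case: F F' => F s k q [F' s' k' q'] /= FF'.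
have e : F = F' by exact: functional_extensionality_dep.
case: _ / e s' k' q' {FF'} => s' k' q'.
by congr GenACS; exact: Prop_irrelevance.
Qed.

Lemma gacs_data_eq (d d' : gacs_data G) :
  (forall p, dJ d p = dJ d' p) -> (forall p, dA d p = dA d' p) ->
  (forall p, dB d p = dB d' p) -> (forall p, dnu d p = dnu d' p) -> d = d'.
Proof.
case: d d' => J A B nu h1 h2 h3 h4 h5 h6 h7 h8 h9.
case=> J' A' B' nu' h1' h2' h3' h4' h5' h6' h7' h8' h9' /=.
move=> eJ eA eB en.
have {}eJ : J = J' := functional_extensionality_dep eJ.
have {}eA : A = A' := functional_extensionality_dep eA.
have {}eB : B = B' := functional_extensionality_dep eB.
have {}en : nu = nu' := functional_extensionality_dep en.
subst; congr GacsData; exact: Prop_irrelevance.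
Qed.

Section OfData.
Variable d : gacs_data G.

Lemma dB_skewE p (xi eta : TsM M p) : xi (dB d p eta) = - eta (dB d p xi).
Proof. exact: ((adj_B_skewP _).1 (@dB_skew _ _ _ _ d p) xi eta). Qed.

Lemma dA_skewE p (r s : G p) : qsp r (dA d p s) = - qsp (dA d p r) s.
Proof. exact: ((adj_A_skewP _).1 (@dA_skew _ _ _ _ d p) r s). Qed.

Lemma dA_squareE p (r : G p) : dA d p (dA d p r) = - r.
Proof. by rewrite -comp_lfunE dA_square opp_lfunE id_lfunE. Qed.

Lemma dJBE p (xi : TsM M p) : dJ d p (dB d p xi) - dB d p (adj_J (dJ d p) xi)
  = adj_nu (dnu d p) (dnu d p xi).
Proof.
by rewrite -!comp_lfunE -dJB add_lfunE opp_lfunE.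
Qed.

Lemma data_adapted p : adapted (dJ d p) (dA d p) (dB d p) (dnu d p)
  (reconstruct (dJ d p) (dA d p) (dB d p) (dnu d p)).
Proof.
apply: reconstruct_adapted;
  [exact: dB_bij|exact: dB_skewE|exact: dJBE|exact: dA_skewE].
Qed.

Definition data_acs : gen_acs G := GenACS (@smooth_reconstruct d)
  (fun p => adapted_skew (@dB_bij _ _ _ _ d p) (@dB_skewE p) (@dJBE p)
     (data_adapted p) (@dA_skewE p))
  (fun p => adapted_square (@dB_bij _ _ _ _ d p) (data_adapted p)
     (@dA_squareE p)).

Lemma data_acs_nondegenerate : gacs_nondegenerate data_acs.
Proof.
move=> p; apply: (eq_bij (@dB_bij _ _ _ _ d p)) => xi.
by rewrite block_endoE /= !linear0 add0r addr0.
Qed.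

End OfData.

Section OfStructure.
Variable JJ : {JJ : gen_acs G | gacs_nondegenerate JJ}.
Let F := gacs (sval JJ).
Let Fskew p := @gacs_skew _ _ _ _ (sval JJ) p.
Let Fsq p := @gacs_square _ _ _ _ (sval JJ) p.
Let Fnd := svalP JJ.

Lemma smooth_components : [/\
  smooth_bmap ((fun p => component_J (F p)) : bmap (TM M) (TM M)),
  smooth_bmap ((fun p => component_B (F p)) : bmap (TsM M) (TM M)),
  smooth_bmap ((fun p => component_nu (F p)) : bmap (TsM M) G) &
  smooth_bmap ((fun p => component_A (F p)) : bmap G G)].
Proof.
have [sv _ sl] := (smooth_to_courant _ fE).1 (@gacs_smooth _ _ _ _ (sval JJ)).
have [sJ sB _] := (smooth_from_courant _ fT).1 sv.
by have [_ snu sA] := (smooth_from_courant _ fG).1 sl.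
Qed.

Lemma smooth_component_At :
  smooth_bmap ((fun p => component_At (F p)) : bmap G G).
Proof.
have [_ sB snu sA] := smooth_components; apply: smooth_bmapD => //.
apply: smooth_bmap_comp (smooth_adj_nu snu) => //.
apply: smooth_bmap_comp => //; apply: smooth_bmap_inv => // p.
exact: component_B_bij (@Fnd p).
Qed.

Let sJ := let: And4 s _ _ _ := smooth_components in s.
Let sB := let: And4 _ s _ _ := smooth_components in s.
Let snu := let: And4 _ _ s _ := smooth_components in s.

Lemma adj_component_B p : adj_B (component_B (F p)) = - component_B (F p).
Proof. exact/adj_B_skewP/(component_B_skew (@Fskew p)). Qed.

Lemma adj_component_At p : adj_A (component_At (F p)) = - component_At (F p).
Proof.
exact/adj_A_skewP/(component_At_skew (@Fskew p) (@Fsq p) (@Fnd p)).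
Qed.

Lemma component_At_comp p :
  (component_At (F p) \o component_At (F p))%VF = - \1%VF.
Proof.
apply/lfunP => r; rewrite comp_lfunE opp_lfunE id_lfunE.
exact: (component_At_sq (@Fskew p) (@Fsq p) (@Fnd p)).
Qed.

Lemma component_JB_comp p : (component_J (F p) \o component_B (F p))%VF
    - (component_B (F p) \o adj_J (component_J (F p)))%VF
  = (adj_nu (component_nu (F p)) \o component_nu (F p))%VF.
Proof.
apply/lfunP => xi; rewrite add_lfunE opp_lfunE [RHS]comp_lfunE.
rewrite -(component_JB (@Fskew p) (@Fsq p)).
by congr (_ - _); exact: comp_lfunE.
Qed.

Definition acs_data : gacs_data G := GacsData sJ smooth_component_At sB snu
  (fun p => component_B_bij (@Fnd p)) adj_component_B adj_component_At
  component_At_comp component_JB_comp.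

(** A structure and the one rebuilt from its data obey the same three rules, so
    they agree; this gives the formulas for [A], [C], [mu] as well as the
    injectivity of the correspondence. *)
Lemma acs_dataK p :
  F p = reconstruct (dJ acs_data p) (dA acs_data p) (dB acs_data p)
          (dnu acs_data p).
Proof.
apply: (adapted_unique (@dB_bij _ _ _ _ acs_data p)) (data_adapted _ p).
exact: (component_adapted (@Fskew p) (@Fsq p) (@Fnd p)).
Qed.

End OfStructure.

End Bijection.

Theorem proposition9 (R : realType) (n : nat) (M : manifold R n)
    (G : quadratic_lie_bundle M)
    (M_connected : connected [set: M])
    (E_neutral : forall p : M, neutral_signature (@courant_sp R n M G p)) :
  exists Phi : {JJ : gen_acs G | gacs_nondegenerate JJ} -> gacs_data G,
    bijective Phi /\
    forall (JJ : {JJ : gen_acs G | gacs_nondegenerate JJ}) (p : M),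
      let J := dJ (Phi JJ) p in
      let At := dA (Phi JJ) p in
      let B := dB (Phi JJ) p in
      let nu := dnu (Phi JJ) p in
      let Binv := (B^-1)%VF in
      has_components (sval JJ p) J
        (At - (nu \o Binv \o adj_nu nu))%VF
        B
        (- (Binv \o ((adj_nu nu \o At \o nu \o Binv) + \1))
           - (adj_J J \o Binv \o J))%VF
        ((nu \o Binv \o J) - (At \o nu \o Binv))%VF
        nu.
Proof.
exists (@acs_data _ _ _ G); split; last first.
  move=> JJ p J At B nu Binv; rewrite [sval JJ p]acs_dataK.
  exact: block_endoE.
exists (fun d => exist _ (data_acs d) (data_acs_nondegenerate d)).
  case=> JJ nd.
  apply: eq_exist; apply: gen_acs_eq => p.
  exact/esym/(acs_dataK (exist _ JJ nd)).
move=> d.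
have eJ p : component_J (data_acs d p) = dJ d p.
  apply/lfunP => X; rewrite component_JE block_endoE /=.
  by rewrite !linear0 !addr0.
have eB p : component_B (data_acs d p) = dB d p.
  apply/lfunP => xi; rewrite component_BE block_endoE /=.
  by rewrite !linear0 add0r addr0.
have enu p : component_nu (data_acs d p) = dnu d p.
  apply/lfunP => xi; rewrite component_nuE block_endoE /=.
  by rewrite !linear0 add0r addr0.
apply: gacs_data_eq => //= p.
(* The definition of At cancels the correction term in the formula for A. *)
apply/lfunP => r; rewrite component_AtE component_AE block_endoE /= eB enu.
by rewrite !linear0 !add0r add_lfunE opp_lfunE !comp_lfunE subrK.
Qed.
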